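(* Let $n\ge 1$ and let $C=(c_{ij})_{1\le i,j\le n}$ be the lower triangular matrix such that $(B^r_0(x),B^r_1(x),\ldots,B^r_{n-1}(x))^T=C(1,x,\ldots,x^{n-1})^T$, where $B^r_0,\dots,B^r_{n-1}$ are the reverse Bessel polynomials; that is, $$c_{ij}=\begin{cases}\dfrac{(2i-j-1)!}{2^{i-j}(j-1)!(i-j)!}, & i\ge j,\\[2mm] 0, & i<j.\end{cases}$$ Then: (i) the pivots of the Neville elimination of $C$ are given by $$p_{ij}=\frac{(2i-2j)!}{2^{i-j}(i-j)!},\quad 1\le j\le i\le n,\quad\text{if } j \text{ is odd},$$ $$p_{ij}=0,\quad 1\le j<i\le n,\qquad p_{jj}=1,\quad 1\le j\le n,\quad\text{if } j\text{ is even},$$ and the multipliers by $$m_{ij}=2i-1-2j,\quad 1\le j<i\le n,\quad \text{if } j\text{ is odd},\qquad m_{ij}=0,\quad 1\le j<i\le n,\quad\text{if } j \text{ is even};$$ (ii) $C$ is a nonsingular totally positive matrix; (iii) the bidiagonal factorization of $C$ is given by $$\mathcal{BD}(C)_{ij}=\begin{cases}2i-2j-1, & i>j \text{ with } j \text{ odd},\\ 1, & i=j,\\ 0, & \text{otherwise},\end{cases}$$ and it can be computed to high relative accuracy.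
   Context: **Reverse Bessel polynomials.** $B^r_n(x)=\sum_{k=0}^n \frac{(n+k)!}{2^k(n-k)!\,k!}x^{n-k}$, $n=0,1,2,\ldots$. **Totally positive (TP).** A matrix is TP if all its minors are nonnegative. **Neville elimination (NE).** Given a nonsingular $n\times n$ matrix $A$, NE produces a sequence $A=A^{(1)}\to\widetilde A^{(1)}\to A^{(2)}\to\widetilde A^{(2)}\to\cdots\to A^{(n)}=\widetilde A^{(n)}=U$ with $U$ upper triangular. The matrix $\widetilde A^{(t)}$ is obtained from $A^{(t)}$ by moving to the bottom the rows with a zero entry in column $t$ below the main diagonal, if necessary. For $t=1,\dots,n-1$, $A^{(t+1)}$ is obtained from $\widetilde A^{(t)}$ by $$a^{(t+1)}_{ij}=\widetilde a^{(t)}_{ij}-\frac{\widetilde a^{(t)}_{it}}{\widetilde a^{(t)}_{i-1,t}}\,\widetilde a^{(t)}_{i-1,j}\quad\text{if } t\le j\le n,\ t<i\le n,\ \widetilde a^{(t)}_{i-1,t}\ne 0,$$ and $a^{(t+1)}_{ij}=\widetilde a^{(t)}_{ij}$ otherwise. The $(i,j)$ pivot is $p_{ij}=\widetilde a^{(j)}_{ij}$ for $1\le j\le i\le n$. The $(i,j)$ multiplier, for $1\le j<i\le n$, is $m_{ij}=p_{ij}/p_{i-1,j}$ if $\widetilde a^{(j)}_{i-1,j}\ne 0$, and $m_{ij}=0$ if $\widetilde a^{(j)}_{i-1,j}=0$. **Bidiagonal factorization.** A nonsingular TP $n\times n$ matrix $A$ has a decomposition $A=F_{n-1}\cdots F_1\,D\,G_1\cdots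 G_{n-1}$, where $D=\mathrm{diag}(p_{11},\dots,p_{nn})$ contains the diagonal pivots of the NE of $A$. The matrix $F_i$ is lower bidiagonal with unit diagonal, its $(r,r-1)$ entry being $m_{r,r-i}$ for $r=i+1,\dots,n$ and $0$ for $2\le r\le i$. The matrix $G_i^T$ is of the same form with $\widetilde m_{r,r-i}$ in place of $m_{r,r-i}$. Here $m_{ij}$ are the multipliers of the NE of $A$ and $\widetilde m_{ij}$ those of the NE of $A^T$. This factorization is encoded by the matrix $\mathcal{BD}(A)$ with $(\mathcal{BD}(A))_{ij}=m_{ij}$ if $i>j$, $\widetilde m_{ji}$ if $i<j$, and $p_{ii}$ if $i=j$. **High relative accuracy (HRA).** An algorithm can be performed with HRA if it only includes products, divisions, sums of numbers of the same sign, and subtractions of initial data. *)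

(* Defs.v *)
From mathcomp Require Import all_boot all_order all_algebra.

Set Implicit Arguments.
Unset Strict Implicit.
Unset Printing Implicit Defensive.

Import Order.TTheory GRing.Theory Num.Theory.
Local Open Scope ring_scope.

(* Rows and columns are indexed by 'I_n, that is from 0: the ordinal i stands
   for the index i.+1 of the usual 1-based notation. *)

Definition ord_sub n (i : 'I_n) (k : nat) : 'I_n :=
  Ordinal (leq_ltn_trans (leq_subr k i) (ltn_ord i)).

Section ReverseBessel.
Variable R : realFieldType.

Definition rev_bessel (n : nat) : {poly R} :=
  \sum_(k < n.+1)
    ((n + k)`!%:R / (2 ^+ k * (n - k)`!%:R * k`!%:R)) *: 'X^(n - k).

(* 1-based indices; the subtractions on nat are exact for 1 <= j <= i. *)
Definition rev_bessel_coef (i j : nat) : R :=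
  if (j <= i)%N
  then (2 * i - j - 1)`!%:R / (2 ^+ (i - j) * (j - 1)`!%:R * (i - j)`!%:R)
  else 0.

Definition rev_bessel_mx n : 'M[R]_n :=
  \matrix_(i < n, j < n) rev_bessel_coef i.+1 j.+1.

End ReverseBessel.

Definition totally_positive (R : realFieldType) m n (A : 'M[R]_(m, n)) : Prop :=
  forall (k : nat) (f : 'I_k -> 'I_m) (g : 'I_k -> 'I_n),
    {homo f : x y / (x < y)%N} -> {homo g : x y / (x < y)%N} ->
    0 <= \det (mxsub f g A).

Section Neville.
Variables (R : realFieldType) (n : nat).
Implicit Types (A : 'M[R]_n) (i j t : 'I_n).

(* The rows above row t stay in place. Among the rows t, t + 1, ... those with
   a zero in column t go to the bottom, and both groups keep their relative
   order. Row t itself is included, since otherwise a zero on the diagonal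
   would block the elimination and the final matrix of a nonsingular A need not
   be upper triangular. *)
Definition ne_order t A : seq 'I_n :=
  [seq i : 'I_n <- enum 'I_n | (i < t)%N] ++
  [seq i : 'I_n <- enum 'I_n | (t <= i)%N && (A i t != 0)] ++
  [seq i : 'I_n <- enum 'I_n | (t <= i)%N && (A i t == 0)].

Definition ne_move t A : 'M[R]_n :=
  \matrix_(i, j) A (nth i (ne_order t A) i) j.

Definition ne_elim t A : 'M[R]_n :=
  \matrix_(i, j)
    if [&& (t <= j)%N, (t < i)%N & A (ord_sub i 1) t != 0]
    then A i j - A i t / A (ord_sub i 1) t * A (ord_sub i 1) j
    else A i j.

(* ne_mx A t is A^(t+1): the columns before column t have been processed. *)
Definition ne_mx A (t : nat) : 'M[R]_n :=
  foldl (fun B s => ne_elim s (ne_move s B)) A (take t (enum 'I_n)).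

Definition ne_pivot A i j : R := ne_move j (ne_mx A j) i j.

Definition ne_mult A i j : R :=
  if ne_pivot A (ord_sub i 1) j != 0
  then ne_pivot A i j / ne_pivot A (ord_sub i 1) j
  else 0.

Definition bd_mx A : 'M[R]_n :=
  \matrix_(i, j)
    if (j < i)%N then ne_mult A i j
    else if (i < j)%N then ne_mult A^T j i
    else ne_pivot A i i.

(* The factors F_k (1 <= k < n) encoded by the strictly lower part of B; the
   1-based condition r >= k + 1 reads k <= r on ordinals. *)
Definition bd_lower (B : 'M[R]_n) (k : nat) : 'M[R]_n :=
  \matrix_(r, c)
    if r == c then 1
    else if (r == c.+1 :> nat) && (k <= r)%N then B r (ord_sub r k)
    else 0.

(* F_(n-1) ... F_1 D G_1 ... G_(n-1) *)
Definition bd_product (B : 'M[R]_n) : 'M[R]_n :=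
  (\big[mulmx/1%:M]_(k <- rev (index_iota 1 n)) bd_lower B k)
  *m diag_mx (\row_i B i i)
  *m (\big[mulmx/1%:M]_(k <- index_iota 1 n) (bd_lower B^T k)^T).

End Neville.

(* Arithmetic algorithms are straight-line programs. The registers first hold
   the initial data; every instruction names two earlier registers and appends
   its result. *)
Inductive instr : Type :=
  | Mul of nat & nat
  | Div of nat & nat
  | Add of nat & nat
  | Sub of nat & nat.

Section HighRelativeAccuracy.
Variable R : realFieldType.
Implicit Types (s data : seq R) (p : seq instr).

Definition eval_instr s (c : instr) : R :=
  match c with
  | Mul a b => s`_a * s`_b
  | Div a b => s`_a / s`_b
  | Add a b => s`_a + s`_b
  | Sub a b => s`_a - s`_b
  end.

(* The d first registers are the initial data. *)
Definition hra_instr (d : nat) s (c : instr) : bool :=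
  match c with
  | Mul a b => (a < size s)%N && (b < size s)%N
  | Div a b => [&& (a < size s)%N, (b < size s)%N & s`_b != 0]
  | Add a b => [&& (a < size s)%N, (b < size s)%N & Num.sg s`_a == Num.sg s`_b]
  | Sub a b => (a < d)%N && (b < d)%N
  end.

Definition run s p : seq R :=
  foldl (fun s c => rcons s (eval_instr s c)) s p.

Fixpoint hra_program (d : nat) s p : bool :=
  if p is c :: p' then
    hra_instr d s c && hra_program d (rcons s (eval_instr s c)) p'
  else true.

Definition hra_computable data m n (A : 'M[R]_(m, n)) : Prop :=
  exists p : seq instr,
    hra_program (size data) data p /\ forall i j, A i j \in run data p.

End HighRelativeAccuracy.

(* Main.v *)
Require Import Defs.
From mathcomp Require Import all_boot all_order all_algebra.
From mathcomp Require Import perm.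
From mathcomp Require Import zify ring.

Set Implicit Arguments.
Unset Strict Implicit.
Unset Printing Implicit Defensive.

Import Order.TTheory GRing.Theory Num.Theory.
Local Open Scope ring_scope.

(** The reverse Bessel polynomials satisfy
    [B_(n+1) = (2n+1) B_n + X^2 B_(n-1)], and everything follows from this
    recurrence, read on the rows of [C]: with rows counted from 0, row [i] of
    [C] is the coefficient sequence of [B_i].

    Neville elimination.  Since [B_i - (2i-1) B_(i-1) = X^2 B_(i-2)], clearing
    column 0 turns row [i >= 2] into [X^2 B_(i-2)] and row 1 into [X]: what is
    left is the identity of size 2 next to a smaller copy of [C].  Column 1 is
    then already clear, and the process restarts at column 2.  So one step out
    of two does nothing, all intermediate matrices are known
    ([ne_mx_rev_bessel]), no row is ever moved, and the pivots and multipliers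
    are constant coefficients of reverse Bessel polynomials and their ratios
    ([ne_pivot_rev_bessel], [ne_mult_rev_bessel]).  The transpose of [C] is
    upper triangular, so its elimination has only zero multipliers.

    Bidiagonal factorization.  The same recurrence gives the rows of every
    partial product [F_m ... F_1] in closed form, [X^(r-k) B_k] for a suitable
    [k] ([bd_lower_prod_bessel]); the last one is [C], and the factors [D] and
    [G_k] are identities ([bd_product_unit_upper]).

    Total positivity.  The factors are nonnegative and bidiagonal, and
    multiplying on the left by such a matrix preserves total positivity
    ([totally_positive_bidiag_mul]): a minor of the product expands as a
    nonnegative combination of minors of the other factor.

    High relative accuracy.  The entries of the bidiagonal factorization are
    small natural numbers, obtained by repeatedly adding 1. *)

(** * Coefficients and recurrence of the reverse Bessel polynomials *)

Lemma coef_rev_bessel (R : realFieldType) n j :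
  (rev_bessel R n)`_j = rev_bessel_coef R n.+1 j.+1.
Proof.
have -> : rev_bessel R n = \poly_(j < n.+1) rev_bessel_coef R n.+1 j.+1.
  rewrite poly_def /rev_bessel (reindex_inj rev_ord_inj) /=.
  apply: eq_bigr => i _; rewrite subSS; have le_i := ltn_ord i.
  rewrite /rev_bessel_coef ltn_ord subSS !subn1 /=.
  rewrite (_ : (n - (n - i) = i)%N); last by lia.
  by rewrite (_ : ((2 * n.+1 - i.+1).-1 = n + (n - i))%N); last by lia.
by rewrite coef_poly /rev_bessel_coef ltnS; case: leqP.
Qed.

(** Indexing by the degree [j] and the codegree [d] removes every truncated
    subtraction from the formula. *)
Lemma coef_rev_bessel_shift (R : realFieldType) d j :
  (rev_bessel R (j + d))`_j
    = (j + 2 * d)`!%:R / (2 ^+ d * j`!%:R * d`!%:R).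
Proof.
rewrite coef_rev_bessel /rev_bessel_coef ltnS leq_addr.
rewrite subSS addKn subSS subn0.
by rewrite (_ : (2 * (j + d).+1 - j.+1 - 1 = j + 2 * d)%N); last by lia.
Qed.

Lemma coef_rev_bessel_gt (R : realFieldType) n j :
  (n < j)%N -> (rev_bessel R n)`_j = 0.
Proof.
by move=> lt_nj; rewrite coef_rev_bessel /rev_bessel_coef leqNgt ltnS lt_nj.
Qed.

Lemma size_rev_bessel (R : realFieldType) n : (size (rev_bessel R n) <= n.+1)%N.
Proof. by apply/leq_sizeP => j /coef_rev_bessel_gt. Qed.

Lemma coef_rev_bessel_diag (R : realFieldType) n : (rev_bessel R n)`_n = 1.
Proof.
have := coef_rev_bessel_shift R 0 n; rewrite !addn0 => ->.
by rewrite expr0 mul1r mulr1 divff // pnatr_eq0 -lt0n fact_gt0.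
Qed.

Lemma coef0_rev_bessel (R : realFieldType) n :
  (rev_bessel R n)`_0 = (2 * n)`!%:R / (2 ^+ n * n`!%:R).
Proof.
by have := coef_rev_bessel_shift R n 0; rewrite !add0n fact0 mulr1.
Qed.

Lemma coef0_rev_bessel_neq0 (R : realFieldType) n : (rev_bessel R n)`_0 != 0.
Proof.
rewrite coef0_rev_bessel mulf_neq0 // ?invr_eq0 ?mulf_neq0 ?expf_neq0 //.
all: by rewrite pnatr_eq0 // -lt0n fact_gt0.
Qed.

Lemma rev_bessel0 (R : realFieldType) : rev_bessel R 0 = 1.
Proof.
apply/polyP => -[|j]; first by rewrite coef_rev_bessel_diag coef1.
by rewrite coef_rev_bessel_gt // coef1.
Qed.

(** The truncations make one formula cover the initial case: it reads
    [B_1 = B_0 + X B_0] for [n = 0], and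
    [B_(n+1) = (2n+1) B_n + X^2 B_(n-1)] for [n > 0].  On coefficients of
    degree [j] and codegree [d] it amounts to
    [(j+2d)(j+2d-1) = 2d(2j+2d-1) + j(j-1)]. *)
Lemma rev_bessel_rec (R : realFieldType) n :
  rev_bessel R n.+1
    = (2 * n.+1%:R - 1) *: rev_bessel R n
      + 'X^(minn n.+1 2) * rev_bessel R n.-1.
Proof.
have fact_neq0 m : (m`!%:R : R) != 0 by rewrite pnatr_eq0 -lt0n fact_gt0.
have two_neq0 m : (2 ^+ m : R) != 0 by rewrite expf_neq0 // pnatr_eq0.
apply/polyP => j; rewrite coefD coefZ coefXnM.
have [lt_nj|le_jn] := ltnP n.+1 j.
  rewrite (coef_rev_bessel_gt _ lt_nj) coef_rev_bessel_gt; last by lia.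
  by rewrite mulr0 add0r coef_rev_bessel_gt ?if_same //; lia.
case: (ltngtP j n.+1) le_jn => // [lt_jn|->] _; last first.
  rewrite coef_rev_bessel_diag coef_rev_bessel_gt // mulr0 add0r.
  rewrite ifN; last by lia.
  by rewrite (_ : (n.+1 - minn n.+1 2 = n.-1)%N) ?coef_rev_bessel_diag //; lia.
have [d n_eq] : exists d, n = (j + d)%N by exists (n - j)%N; lia.
rewrite {n lt_jn}n_eq -addnS !coef_rev_bessel_shift.
case: j => [|[|j]].
- rewrite !add0n ifT; last by lia.
  rewrite !mulnS !addSn !add0n !factS !exprS !natrM.
  move: (2 ^+ d) (two_neq0 d) => q q_neq0; rewrite !mulrS; field.
  by rewrite !fact_neq0 q_neq0 /= -?mulrS !pnatr_eq0.
- have -> : (1 < minn (1 + d.+1) 2)%N by lia.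
  rewrite !mulnS !addSn !add0n !factS !exprS !natrM.
  move: (2 ^+ d) (two_neq0 d) => q q_neq0; rewrite !mulrS; field.
  by rewrite !fact_neq0 q_neq0 /= -?mulrS !pnatr_eq0.
have -> : (j.+2 < minn (j.+2 + d.+1) 2)%N = false by lia.
rewrite (_ : (j.+2 - minn (j.+2 + d.+1) 2 = j)%N); last by lia.
rewrite (_ : ((j.+2 + d).-1 = j + d.+1)%N); last by lia.
rewrite !coef_rev_bessel_shift !mulnS !addSn !addnS !factS !exprS !natrM.
move: (2 ^+ d) (two_neq0 d) => q q_neq0.
rewrite !mulrS !natrD ?natrM; field.
by rewrite !fact_neq0 q_neq0 /= -?mulrS !pnatr_eq0.
Qed.

(** * Neville elimination in degenerate columns *)

(** The reordering is stable, so it is trivial when the zeros of the pivot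
    column already come last.  The two sequences of indices are increasing with
    the same elements. *)
Lemma ne_moveE (R : realFieldType) n (A : 'M[R]_n) (t : 'I_n) :
    (forall i j : 'I_n, (t <= i < j)%N -> A i t = 0 -> A j t = 0) ->
  ne_move t A = A.
Proof.
move=> zeros_last.
have -> : ne_move t A = \matrix_(i, j) A (nth i (enum 'I_n) i) j.
  suff order_id : ne_order t A = enum 'I_n.
    by apply/matrixP => i j; rewrite !mxE order_id.
  have enum_sorted : sorted (fun i j : 'I_n => (i < j)%N) (enum 'I_n).
    by have := iota_ltn_sorted 0 n; rewrite -val_enum_ord sorted_map.
  have ltn_tr : transitive (fun i j : 'I_n => (i < j)%N).
    by move=> i j k; apply: ltn_trans.
  apply: (irr_sorted_eq ltn_tr) => // [i||i]; first by rewrite ltnn.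
    move: enum_sorted; rewrite !(sorted_pairwise ltn_tr) => enum_sorted.
    rewrite /ne_order !pairwise_cat !allrel_catr.
    rewrite !(pairwise_filter _ enum_sorted).
    rewrite !andbT -!andbA; apply/and3P; split; apply/allrelP => i j.
    - by rewrite !mem_filter => /andP[lti _] /andP[/andP[gej _] _]; lia.
    - by rewrite !mem_filter => /andP[lti _] /andP[/andP[gej _] _]; lia.
    rewrite !mem_filter => /andP[/andP[lei Ai] _] /andP[/andP[lej /eqP Aj] _].
    rewrite ltnNge leq_eqVlt; apply/negP => /orP[/eqP/val_inj eq_ij|lt_ji].
      by rewrite -eq_ij Aj eqxx in Ai.
    by move: Ai; rewrite (zeros_last j i) ?eqxx // lej lt_ji.
  have enumP (p : pred 'I_n) : (i \in [seq x <- enum 'I_n | p x]) = p i.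
    by rewrite mem_filter mem_enum inE andbT.
  rewrite !mem_cat !enumP mem_enum inE.
  by case: leqP => //= _; case: eqP.
by apply/matrixP => i j; rewrite mxE nth_ord_enum.
Qed.

Lemma ne_mxS (R : realFieldType) n (A : 'M[R]_n) (t : 'I_n) :
  ne_mx A t.+1 = ne_elim t (ne_move t (ne_mx A t)).
Proof.
by rewrite /ne_mx (take_nth t) ?size_enum_ord // foldl_rcons nth_ord_enum.
Qed.

(** Row [t] may hold a zero, but it is followed by zeros only; and every row
    below it is reduced by a zero multiple of the previous one. *)
Lemma ne_step_zero_col (R : realFieldType) n (A : 'M[R]_n) (t : 'I_n) :
    (forall i : 'I_n, (t < i)%N -> A i t = 0) ->
  ne_move t A = A /\ ne_elim t A = A.
Proof.
move=> Acol; split.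
  by apply: ne_moveE => i j /andP[le_ti lt_ij] _; apply: Acol; lia.
apply/matrixP => i j; rewrite mxE; case: ifP => // /and3P[_ lt_ti _].
by rewrite (Acol _ lt_ti) mul0r mul0r subr0.
Qed.

(** Every column is degenerate, so the elimination of an upper triangular matrix
    changes nothing, even if the matrix is singular. *)
Lemma ne_mx_upper (R : realFieldType) n (A : 'M[R]_n) t :
    (forall i j : 'I_n, (j < i)%N -> A i j = 0) -> (t <= n)%N ->
  ne_mx A t = A.
Proof.
move=> Aup; elim: t => [|t IHt] lt_tn; first by rewrite /ne_mx take0.
have [mv el] := ne_step_zero_col (t := Ordinal lt_tn) (fun i => Aup i _).
by rewrite (ne_mxS A (Ordinal lt_tn)) IHt ?(ltnW lt_tn) // mv el.
Qed.

Lemma ne_mult_upper (R : realFieldType) n (A : 'M[R]_n) (i j : 'I_n) :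
    (forall i j : 'I_n, (j < i)%N -> A i j = 0) -> (j < i)%N ->
  ne_mult A i j = 0.
Proof.
move=> Aup lt_ji; rewrite /ne_mult {2}/ne_pivot (ne_mx_upper Aup) 1?ltnW //.
have [-> _] := ne_step_zero_col (t := j) (fun i => Aup i _).
by rewrite Aup // mul0r if_same.
Qed.

(** * Neville elimination of the reverse Bessel matrix *)

(** The block diagonal matrix with an identity block of size [2s] followed by a
    reverse Bessel matrix: for [i < 2s] both truncations apply and row [i] is
    [X^i B_0 = X^i]. *)
Definition shifted_bessel_mx (R : realFieldType) n (s : nat) : 'M[R]_n :=
  \matrix_(i < n, j < n) ('X^(minn i s.*2) * rev_bessel R (i - s.*2))`_j.

Lemma rev_bessel_mxE (R : realFieldType) n (i j : 'I_n) :
  rev_bessel_mx R n i j = (rev_bessel R i)`_j.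
Proof. by rewrite mxE coef_rev_bessel. Qed.

Lemma rev_bessel_mx_shifted (R : realFieldType) n :
  rev_bessel_mx R n = shifted_bessel_mx R n 0.
Proof.
by apply/matrixP => i j; rewrite rev_bessel_mxE mxE minn0 mul1r subn0.
Qed.

Lemma shifted_even_col (R : realFieldType) n s (i t : 'I_n) :
  val t = s.*2 -> (t <= i)%N ->
  shifted_bessel_mx R n s i t = (rev_bessel R (i - t))`_0.
Proof.
move=> t_eq le_ti; rewrite mxE -t_eq (minn_idPr le_ti) coefXnM ltnn subnn //.
Qed.

Lemma shifted_odd_col (R : realFieldType) n s (i t : 'I_n) :
  (t.+1 = s.*2)%N -> (t <= i)%N ->
  shifted_bessel_mx R n s i t = (i == t)%:R.
Proof.
move=> t_eq le_ti; rewrite mxE coefXnM -t_eq -val_eqE /=.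
case: (ltngtP t i) le_ti => // [lt_ti|<-] _.
  by rewrite ifT //; lia.
rewrite ifN; last by lia.
rewrite (_ : (t - minn t t.+1 = 0)%N); last by lia.
by rewrite (_ : (t - t.+1 = 0)%N) ?rev_bessel0 ?coef1 //; lia.
Qed.

(** An even column of the remaining Bessel block starts it and has no zero from
    the diagonal down; an odd column is a column of the identity block. *)
Lemma ne_move_shifted (R : realFieldType) n (t : 'I_n) :
  ne_move t (shifted_bessel_mx R n (uphalf t))
    = shifted_bessel_mx R n (uphalf t).
Proof.
apply: ne_moveE => i j /andP[le_ti lt_ij].
have le_tj := ltnW (leq_ltn_trans le_ti lt_ij).
have [t_odd|t_even] := boolP (odd t).
  have t_eq : (t.+1 = (uphalf t).*2)%N by lia.
  rewrite !(shifted_odd_col _ t_eq) //.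
  by rewrite -!val_eqE /= (_ : (j == t :> nat) = false) //; lia.
have t_eq : (val t = (uphalf t).*2)%N by rewrite /=; lia.
rewrite (shifted_even_col _ t_eq) // => /eqP.
by rewrite (negPf (coef0_rev_bessel_neq0 _ _)).
Qed.

(** The last term of the recurrence has no constant coefficient. *)
Lemma rev_bessel0_ratio (R : realFieldType) k :
  (0 < k)%N ->
  (rev_bessel R k)`_0 / (rev_bessel R k.-1)`_0 = 2 * k%:R - 1.
Proof.
case: k => // k _; rewrite rev_bessel_rec coefD coefZ coefXnM ifT; last by lia.
by rewrite addr0 mulfK // coef0_rev_bessel_neq0.
Qed.

(** At an even column the multipliers are those of the recurrence, which turns
    [B_a] into [X^2 B_(a-2)] for [a >= 2] and [B_1] into [X]: the identity block
    grows by 2. *)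
Lemma ne_elim_shifted (R : realFieldType) n (t : 'I_n) :
  ne_elim t (shifted_bessel_mx R n (uphalf t))
    = shifted_bessel_mx R n (uphalf t.+1).
Proof.
have [t_odd|t_even] := boolP (odd t).
  have t_eq : (t.+1 = (uphalf t).*2)%N by lia.
  rewrite (_ : uphalf t.+1 = uphalf t); last by lia.
  apply: (ne_step_zero_col _).2 => i lt_ti.
  rewrite (shifted_odd_col _ t_eq) 1?ltnW //.
  by rewrite (_ : (i == t) = false) // -val_eqE gtn_eqF.
have t_eq : (val t = (uphalf t).*2)%N by rewrite /=; lia.
rewrite (_ : uphalf t.+1 = (uphalf t).+1); last by lia.
apply/matrixP => i j; rewrite [LHS]mxE.
have [lt_ti|le_it] := ltnP t i; last first.
  rewrite andbF !mxE doubleS -t_eq /=.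
  rewrite (_ : minn i t = i) 1?(_ : minn i t.+2 = i); try lia.
  by rewrite (_ : (i - t = 0)%N) 1?(_ : (i - t.+2 = 0)%N) //; lia.
have [lt_jt|le_tj] := ltnP j t.
  by rewrite !mxE doubleS -t_eq !coefXnM !ifT //; lia.
rewrite /= (shifted_even_col _ t_eq) /=; last by lia.
rewrite coef0_rev_bessel_neq0 (shifted_even_col _ t_eq) 1?ltnW //.
rewrite (_ : (i - 1 - t = (i - t).-1)%N); last by lia.
rewrite rev_bessel0_ratio ?subn_gt0 //.
rewrite !mxE doubleS -t_eq /= (_ : minn i t = t); last by lia.
rewrite (_ : minn (i - 1) t = t); last by lia.
have -> : minn i t.+2 = (t + minn (i - t) 2)%N by lia.
have -> : (i - 1 - t = (i - t).-1)%N by lia.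
have -> : (i - t.+2 = (i - t).-2)%N by lia.
have : (0 < i - t)%N by rewrite subn_gt0.
case: (i - t)%N => // k _; rewrite [rev_bessel R k.+1]rev_bessel_rec /=.
rewrite -coefZ -coefB mulrDr -scalerAr addrAC subrr add0r mulrA.
by rewrite -exprD.
Qed.

Lemma ne_mx_rev_bessel (R : realFieldType) n t : (t <= n)%N ->
  ne_mx (rev_bessel_mx R n) t = shifted_bessel_mx R n (uphalf t).
Proof.
elim: t => [|t IHt] lt_tn; first by rewrite /ne_mx take0 rev_bessel_mx_shifted.
rewrite (ne_mxS _ (Ordinal lt_tn)) IHt 1?ltnW //.
rewrite (ne_move_shifted R (Ordinal lt_tn)).
by rewrite (ne_elim_shifted R (Ordinal lt_tn)).
Qed.

Lemma ne_pivot_rev_bessel (R : realFieldType) n (i j : 'I_n) : (j <= i)%N ->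
  ne_pivot (rev_bessel_mx R n) i j
    = if odd j then (i == j)%:R else (rev_bessel R (i - j))`_0.
Proof.
move=> le_ji; rewrite /ne_pivot ne_mx_rev_bessel 1?ltnW // ne_move_shifted.
case: ifP => odd_j; first by apply: shifted_odd_col => //; lia.
by apply: shifted_even_col => //=; lia.
Qed.

Lemma ne_mult_rev_bessel (R : realFieldType) n (i j : 'I_n) : (j < i)%N ->
  ne_mult (rev_bessel_mx R n) i j
    = if odd j then 0 else 2 * i.+1%:R - 1 - 2 * j.+1%:R.
Proof.
move=> lt_ji; have le_j_pred : (j <= ord_sub i 1)%N by rewrite /=; lia.
rewrite /ne_mult (ne_pivot_rev_bessel _ le_j_pred).
rewrite (ne_pivot_rev_bessel _ (ltnW lt_ji)) /=.
case: (odd j).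
  by rewrite -[i == j]val_eqE (gtn_eqF lt_ji) mul0r if_same.
rewrite coef0_rev_bessel_neq0 (_ : (i - 1 - j = (i - j).-1)%N); last by lia.
rewrite rev_bessel0_ratio ?subn_gt0 // natrB 1?ltnW // -(addn1 i) -(addn1 j).
by rewrite !natrD; ring.
Qed.

(** * Total positivity of products of bidiagonal matrices *)

(** Expanding each row of the product by multilinearity: this is the
    Cauchy-Binet formula before the terms with the same set of rows of [A] are
    gathered. *)
Lemma det_mxsub_mul (R : comNzRingType) m n p k
    (f : 'I_k -> 'I_m) (g : 'I_k -> 'I_p)
    (F : 'M[R]_(m, n)) (A : 'M[R]_(n, p)) :
  \det (mxsub f g (F *m A))
    = \sum_(h : {ffun 'I_k -> 'I_n})
        (\prod_i F (f i) (h i)) * \det (mxsub h g A).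
Proof.
transitivity (\sum_(s : 'S_k)
    \sum_(h : {ffun 'I_k -> 'I_n})
    (-1) ^+ s * \prod_i (F (f i) (h i) * A (h i) (g (s i)))).
  apply: eq_bigr => s _; rewrite -big_distrr.
  rewrite -(bigA_distr_bigA (fun i j => F (f i) j * A j (g (s i)))) /=.
  by congr (_ * _); apply: eq_bigr => i _; rewrite !mxE.
rewrite exchange_big; apply: eq_bigr => h _; rewrite big_distrr /=.
apply: eq_bigr => s _; rewrite big_split mulrCA /=.
by congr (_ * (_ * _)); apply: eq_bigr => i _; rewrite mxE.
Qed.

(** In the expansion over maps [h] of the minor on rows [f], bidiagonality
    forces [h i] to be [f i] or [f i - 1].  As [f] increases strictly, [h] is
    weakly increasing; either it is strictly increasing and gives a minor of
    [A], or it repeats a row and the determinant vanishes. *)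
Lemma totally_positive_bidiag_mul (R : realFieldType) m n (F : 'M[R]_m)
    (A : 'M[R]_(m, n)) :
    (forall r c, 0 <= F r c) ->
    (forall r c : 'I_m, F r c != 0 -> (c <= r <= c.+1)%N) ->
  totally_positive A -> totally_positive (F *m A).
Proof.
move=> F_ge0 F_bidiag A_tp k f g f_mono g_mono.
rewrite det_mxsub_mul; apply: sumr_ge0 => h _.
have [/forallP F_h|/forallPn[i /negPn/eqP F0]] :=
    boolP [forall i, F (f i) (h i) != 0]; last first.
  by rewrite (bigD1 i) //= F0 !mul0r.
apply: mulr_ge0; first by apply: prodr_ge0.
have [/injectiveP h_inj|/injectivePn[i [j neq_ij eq_h]]] :=
    boolP (injectiveb h); last first.
  by rewrite (determinant_alternate neq_ij) // => c; rewrite !mxE eq_h.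
apply: A_tp => // i j lt_ij; have lt_f := f_mono _ _ lt_ij.
have /andP[_ le_fh] := F_bidiag _ _ (F_h j).
have /andP[le_hf _] := F_bidiag _ _ (F_h i).
have neq_h : h i != h j :> nat.
  by apply: contraTneq lt_ij => /val_inj/h_inj->; rewrite ltnn.
by rewrite ltn_neqAle neq_h -ltnS (leq_trans (leq_ltn_trans le_hf lt_f) le_fh).
Qed.

(** A minor on rows [f] and columns [g] has a zero row unless every value of [f]
    is one of [g]; two strictly increasing maps with the same range agree, and
    the minor is then that of an identity matrix. *)
Lemma totally_positive1 (R : realFieldType) n :
  totally_positive (1%:M : 'M[R]_n).
Proof.
move=> k f g f_mono g_mono.
have codom_mono (h : 'I_k -> 'I_n) : {homo h : x y / (x < y)%N} ->
    sorted (fun x y : 'I_n => (x < y)%N) (codom h).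
  move=> h_mono; rewrite codomE (homo_sorted h_mono) //.
  by have := iota_ltn_sorted 0 k; rewrite -val_enum_ord sorted_map.
have ltn_tr : transitive (fun x y : 'I_n => (x < y)%N).
  by move=> x y z; apply: ltn_trans.
have ltn_irr : irreflexive (fun x y : 'I_n => (x < y)%N).
  by move=> x; apply: ltnn.
have [/forallP f_sub|/forallPn[i f_i]] := boolP [forall i, f i \in codom g].
  suff codom_fg : codom f = codom g.
    have fg i : f i = g i.
      by move: codom_fg; rewrite !codomE => /eq_in_map; apply; rewrite mem_enum.
    rewrite (_ : mxsub f g _ = 1%:M) ?det1 //.
    apply/matrixP => i j; rewrite !mxE -fg.
    have [->|neq_ij] := eqVneq i j; first by rewrite eqxx.
    move: neq_ij; rewrite -val_eqE neq_ltn.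
    by case/orP=> /f_mono lt_f; rewrite -val_eqE;
      rewrite ?(ltn_eqF lt_f) ?(gtn_eqF lt_f).
  have sub_fg : {subset codom f <= codom g} by move=> _ /codomP[i ->].
  apply: (irr_sorted_eq ltn_tr ltn_irr); rewrite ?codom_mono //.
  have f_uniq := sorted_uniq ltn_tr ltn_irr (codom_mono f f_mono).
  by apply: (uniq_min_size f_uniq sub_fg _).2; rewrite !size_codom.
rewrite (expand_det_row _ i) big1 // => j _; rewrite !mxE.
rewrite (_ : (f i == g j) = false) ?mul0r //.
by apply: contraNF f_i => /eqP->; apply: codom_f.
Qed.

(** * The bidiagonal factorization *)

Lemma bd_lower_ge0 (R : realFieldType) n (B : 'M[R]_n) k :
  (forall i j : 'I_n, (j < i)%N -> 0 <= B i j) -> (0 < k)%N ->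
  forall r c, 0 <= bd_lower B k r c.
Proof.
move=> B_ge0 k_gt0 r c; rewrite mxE; case: eqP => // _.
by case: ifP => // /andP[/eqP r_eq le_kr]; apply: B_ge0 => /=; lia.
Qed.

Lemma bd_lower_bidiag (R : realFieldType) n (B : 'M[R]_n) k (r c : 'I_n) :
  bd_lower B k r c != 0 -> (c <= r <= c.+1)%N.
Proof.
rewrite mxE; case: (eqVneq r c) => [-> _|_]; first by rewrite leqnn leqnSn.
by case: ifP => [/andP[/eqP-> _] _|]; rewrite ?leqnn ?leqnSn ?eqxx.
Qed.

Lemma bd_lower_mul (R : realFieldType) n m (B : 'M[R]_n) k
    (A : 'M[R]_(n, m)) r c :
  (0 < k)%N ->
  (bd_lower B k *m A) r c
    = A r c + (if (k <= r)%N then B r (ord_sub r k) * A (ord_sub r 1) c else 0).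
Proof.
move=> k_gt0; rewrite mxE (bigD1 r) //= !mxE eqxx mul1r; congr (_ + _).
case: leqP => [le_kr|lt_rk]; last first.
  apply: big1 => s /negPf neq_sr; rewrite mxE eq_sym neq_sr.
  by rewrite leqNgt lt_rk andbF mul0r.
rewrite (bigD1 (ord_sub r 1)) /=; last by rewrite -val_eqE /=; lia.
rewrite mxE ifN; last by rewrite -val_eqE /=; lia.
rewrite ifT; last by rewrite /=; lia.
rewrite big1 ?addr0 // => s /andP[/negPf neq_sr neq_s].
rewrite mxE eq_sym neq_sr ifN ?mul0r //.
apply: contraNN neq_s => /andP[/eqP r_eq _].
by rewrite -val_eqE /= r_eq subn1.
Qed.

Lemma totally_positive_bd_lower_prod (R : realFieldType) n (B : 'M[R]_n)
    (s : seq nat) :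
    (forall i j : 'I_n, (j < i)%N -> 0 <= B i j) -> all (leq 1) s ->
  totally_positive (\big[mulmx/1%:M]_(k <- s) bd_lower B k).
Proof.
move=> B_ge0; elim: s => [|k s IHs] /=.
  by rewrite big_nil => _; apply: totally_positive1.
case/andP=> k_gt0 s_gt0; rewrite big_cons; apply: totally_positive_bidiag_mul.
- exact: bd_lower_ge0.
- exact: bd_lower_bidiag.
exact: IHs.
Qed.

Definition bessel_bd_mx (R : realFieldType) n : 'M[R]_n :=
  \matrix_(i < n, j < n)
     (if (j < i)%N && odd j.+1 then 2 * i.+1%:R - 2 * j.+1%:R - 1
      else if i == j then 1
      else 0).

Lemma bd_mx_rev_bessel (R : realFieldType) n :
  bd_mx (rev_bessel_mx R n) = bessel_bd_mx R n.
Proof.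
apply/matrixP => i j; rewrite !mxE.
case: (ltngtP j i) => [lt_ji|lt_ij|eq_ji] /=.
- rewrite ne_mult_rev_bessel // if_neg -[i == j]val_eqE (gtn_eqF lt_ji).
  by case: ifP => // _; ring.
- rewrite -val_eqE (ltn_eqF lt_ij) ne_mult_upper // => r c lt_cr.
  by rewrite mxE rev_bessel_mxE coef_rev_bessel_gt.
have -> : j = i by apply: val_inj.
rewrite ne_pivot_rev_bessel // eqxx.
by rewrite subnn rev_bessel0 coef1 if_same.
Qed.

(** Row [r] of [F_m ... F_1] is changed by [F_k] only if [k <= r] and [r - k] is
    even; [k] below is the index of the last such factor, so that row [r] has
    become [X^(r-k) B_k].  If there is none, then [k = 0] and the row is still
    [X^r], as in the identity. *)
Definition bessel_partial_mx (R : realFieldType) n (m : nat) : 'M[R]_n :=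
  \matrix_(r < n, c < n)
    (let k := (minn m r - odd (r - m))%N in
     'X^(r - k) * rev_bessel R k)`_c.

(** When [F_k] acts on row [r], rows [r] and [r-1] of the previous product are
    [X^(r-k+2) B_(k-2)] and [X^(r-k) B_(k-1)] (just [X^r] and [X^(r-1)] if
    [k = 1]), and the entry of [F_k] is [2k-1]: the recurrence gives
    [X^(r-k) B_k]. *)
Lemma bd_lower_prod_bessel (R : realFieldType) n m :
  \big[mulmx/1%:M]_(k <- rev (index_iota 1 m.+1)) bd_lower (bessel_bd_mx R n) k
    = bessel_partial_mx R n m.
Proof.
elim: m => [|m IHm].
  rewrite big_nil; apply/matrixP => r c; rewrite !mxE /= min0n sub0n subn0.
  by rewrite rev_bessel0 mulr1 coefXn eq_sym.
have -> : index_iota 1 m.+2 = index_iota 1 m.+1 ++ [:: m.+1].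
  by rewrite /index_iota !subSS !subn0 -(addn1 m) iotaD add1n addn1.
rewrite rev_cat big_cons.
rewrite IHm; apply/matrixP => r c; rewrite bd_lower_mul // !mxE /=.
have [lt_mr|le_rm] := ltnP m r; last first.
  rewrite addr0 (_ : minn m.+1 r = r); last by lia.
  by rewrite (_ : (r - m = 0)%N) 1?(_ : (r - m.+1 = 0)%N) //; lia.
rewrite (_ : (r - m.+1 < r)%N = true) /=; last by lia.
rewrite (_ : minn m.+1 r = m.+1); last by lia.
rewrite (_ : minn m (r - 1) = m) 1?(_ : (r - 1 - m = r - m.+1)%N); try lia.
have -> : odd (r - m) = ~~ odd (r - m.+1) by lia.
case: ifP => [/negPf odd_d|/negbFE odd_d]; rewrite odd_d /=; last first.
  have -> : (r == ord_sub r m.+1) = false by rewrite -val_eqE /=; lia.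
  rewrite mul0r addr0.
  by rewrite subn0 subSS subn0.
rewrite -coefZ -coefD !subn0 [rev_bessel R m.+1]rev_bessel_rec mulrDr addrC.
rewrite -scalerAr mulrA -exprD.
have -> : 2 * r.+1%:R - 2 * (r - m.+1).+1%:R - 1 = 2 * m.+1%:R - 1 :> R.
  rewrite -subSn // subSS natrB; last by lia.
  by rewrite -(addn1 m) -(addn1 r) !natrD; ring.
rewrite (_ : (r - 1 - m = r - m.+1)%N) ?subn1; last by lia.
by rewrite (_ : (r - m.+1 + minn m.+1 2 = r - m.-1)%N); last by lia.
Qed.

Lemma bd_product_unit_upper (R : realFieldType) n (B : 'M[R]_n) :
    (forall i j : 'I_n, (i < j)%N -> B i j = 0) -> (forall i, B i i = 1) ->
  bd_product B = \big[mulmx/1%:M]_(k <- rev (index_iota 1 n)) bd_lower B k.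
Proof.
move=> B_low B_diag; rewrite /bd_product.
have -> : diag_mx (\row_i B i i) = 1%:M.
  by apply/matrixP => i j; rewrite !mxE B_diag.
suff -> : \big[mulmx/1%:M]_(k <- index_iota 1 n) (bd_lower B^T k)^T = 1%:M.
  by rewrite !mulmx1.
rewrite big_seq; apply: (big_ind (fun A => A = 1%:M)) => // [_ _ -> ->|k].
  exact: mulmx1.
rewrite mem_index_iota => /andP[k_gt0 _]; apply/matrixP => r c; rewrite !mxE.
rewrite eq_sym; case: eqP => // _; case: ifP => // /andP[/eqP c_eq le_kc].
by rewrite B_low //=; lia.
Qed.

Lemma rev_bessel_mx_prod (R : realFieldType) n :
  rev_bessel_mx R n
    = \big[mulmx/1%:M]_(k <- rev (index_iota 1 n))
        bd_lower (bessel_bd_mx R n) k.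
Proof.
case: n => [|n]; first by apply/matrixP => -[].
rewrite bd_lower_prod_bessel; apply/matrixP => r c.
rewrite rev_bessel_mxE mxE /= (minn_idPr _) -1?ltnS //.
by rewrite (_ : (r - n = 0)%N) ?subn0 ?subnn ?mul1r //; have := ltn_ord r; lia.
Qed.

(** * The reverse Bessel matrix *)

Lemma rev_bessel_mx_unit (R : realFieldType) n : rev_bessel_mx R n \in unitmx.
Proof.
rewrite unitmxE det_trig; last first.
  by apply/is_trig_mxP => i j lt_ij; rewrite rev_bessel_mxE coef_rev_bessel_gt.
by rewrite big1 ?unitr1 // => i _; rewrite rev_bessel_mxE coef_rev_bessel_diag.
Qed.

Lemma totally_positive_rev_bessel (R : realFieldType) n :
  totally_positive (rev_bessel_mx R n).
Proof.
rewrite rev_bessel_mx_prod.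
apply: totally_positive_bd_lower_prod => [i j lt_ji|].
  rewrite mxE lt_ji /=; case: ifP => _; last by case: ifP.
  rewrite -mulrBr -natrB ?ltnS 1?ltnW // subSS -natrM subr_ge0 ler1n.
  by rewrite muln_gt0 subn_gt0 lt_ji.
by apply/allP => k; rewrite mem_rev mem_index_iota => /andP[].
Qed.

Lemma rev_bessel_mx_basis (R : realFieldType) n :
  \col_(i < n) rev_bessel R i
    = map_mx polyC (rev_bessel_mx R n) *m \col_(j < n) ('X^j : {poly R}).
Proof.
apply/matrixP => i c; rewrite !mxE.
rewrite -[LHS](@take_poly_id _ n); last first.
  exact: leq_trans (size_rev_bessel R i) (ltn_ord i).
rewrite [take_poly _ _]poly_def; apply: eq_bigr => j _.
by rewrite mxE rev_bessel_mxE mxE mul_polyC.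
Qed.

(** * High relative accuracy *)

Lemma hra_program_rcons (R : realFieldType) d (s : seq R) p c :
  hra_program d s (rcons p c) = hra_program d s p && hra_instr d (run s p) c.
Proof. by elim: p s => [|c' p IHp] s /=; rewrite ?andbT // IHp andbA. Qed.

Lemma run_rcons (R : realFieldType) (s : seq R) p c :
  run s (rcons p c) = rcons (run s p) (eval_instr (run s p) c).
Proof. exact: foldl_rcons. Qed.

Lemma hra_nats (R : realFieldType) m :
  exists p : seq instr, hra_program 1 [:: 1 : R] p
    /\ run [:: 1 : R] p = mkseq (fun k => k.+1%:R) m.+1.
Proof.
elim: m => [|m [p [p_ok p_run]]]; first by exists [::].
exists (rcons p (Add 0 m)).
rewrite hra_program_rcons run_rcons p_ok p_run /= !size_map !size_iota ltnSn.
rewrite (@nth_mkseq _ 0 _ m.+1 m) //.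
by rewrite mkseqS /= -(add1n m.+1) natrD !gtr0_sg ?ltr0n ?eqxx.
Qed.

(** The register file lists [1, ..., N+1]; a final [1 - 1], allowed because 1
    is an initial datum, provides 0. *)
Lemma hra_nat_mx (R : realFieldType) m n (A : 'M[R]_(m, n)) N :
    (forall i j, exists2 k, (k <= N)%N & A i j = k%:R) ->
  hra_computable [:: 1] A.
Proof.
move=> A_nat; have [p [p_ok p_run]] := hra_nats R N.
exists (rcons p (Defs.Sub 0 0)); split; first by rewrite hra_program_rcons p_ok.
move=> i j; have [k le_kN ->] := A_nat i j.
rewrite run_rcons p_run mem_rcons inE /= subrr.
case: k le_kN => [|k] lt_kN; first by rewrite eqxx.
by apply/orP; right; apply: (map_f (fun k => k.+1%:R)); rewrite mem_iota; lia.
Qed.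

(** * Pivots, total positivity and bidiagonal factorization *)

Theorem theorem5 (R : realFieldType) (n : nat) (n_gt0 : (0 < n)%N) :
  let C := rev_bessel_mx R n in
  (* the defining relation of C *)
  (\col_(i < n) rev_bessel R i
     = map_mx polyC C *m \col_(j < n) ('X^j : {poly R})) /\
  (* (i) *)
  ((forall i j : 'I_n, (j <= i)%N -> odd j.+1 ->
      ne_pivot C i j
        = (2 * i.+1 - 2 * j.+1)`!%:R
            / (2 ^+ (i.+1 - j.+1) * (i.+1 - j.+1)`!%:R)) /\
   (forall i j : 'I_n, (j < i)%N -> ~~ odd j.+1 -> ne_pivot C i j = 0) /\
   (forall j : 'I_n, ~~ odd j.+1 -> ne_pivot C j j = 1) /\
   (forall i j : 'I_n, (j < i)%N -> odd j.+1 ->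
      ne_mult C i j = 2 * i.+1%:R - 1 - 2 * j.+1%:R) /\
   (forall i j : 'I_n, (j < i)%N -> ~~ odd j.+1 -> ne_mult C i j = 0)) /\
  (* (ii) *)
  (C \in unitmx /\ totally_positive C) /\
  (* (iii) *)
  (bd_mx C = \matrix_(i < n, j < n)
     (if (j < i)%N && odd j.+1 then 2 * i.+1%:R - 2 * j.+1%:R - 1
      else if i == j then 1
      else 0) /\
   C = bd_product (bd_mx C) /\
   hra_computable [:: 1] (bd_mx C)).
Proof.
move=> C; rewrite bd_mx_rev_bessel; split; first exact: rev_bessel_mx_basis.
split; last split.
- split=> [i j le_ji even_j|].
    rewrite ne_pivot_rev_bessel // ifN //.
    by rewrite coef0_rev_bessel -mulnBr subSS.
  split=> [i j lt_ji|].
    rewrite oddS negbK => odd_j.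
    by rewrite ne_pivot_rev_bessel 1?ltnW // odd_j -val_eqE (gtn_eqF lt_ji).
  split=> [j|].
    rewrite oddS negbK => odd_j.
    by rewrite ne_pivot_rev_bessel // odd_j eqxx.
  split=> [i j lt_ji even_j|i j lt_ji].
    by rewrite ne_mult_rev_bessel // ifN.
  by rewrite oddS negbK ne_mult_rev_bessel // => ->.
- split; [exact: rev_bessel_mx_unit | exact: totally_positive_rev_bessel].
split=> //; split.
  rewrite bd_product_unit_upper; first exact: rev_bessel_mx_prod.
    by move=> i j lt_ij; rewrite mxE ltnNge ltnW //= -val_eqE (ltn_eqF lt_ij).
  by move=> i; rewrite mxE ltnn eqxx.
apply: (@hra_nat_mx _ _ _ _ (2 * n)) => i j; rewrite mxE.
case: ifP => [/andP[lt_ji _]|_]; last first.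
  by case: ifP => _; [exists 1%N | exists 0%N] => //; lia.
exists (2 * (i - j) - 1)%N; first by have := ltn_ord i; lia.
have le_ji := ltnW lt_ji; rewrite natrB ?natrM ?natrB //; last by lia.
by rewrite -(addn1 i) -(addn1 j) !natrD; ring.
Qed.
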